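(* Let $C_n(a,b)$ be a connected $2$-regular circulant digraph, let $l\ge1$, $0\le k\le l$ with $la+k(b-a)=\omega n$ for an integer $\omega$, and let $Q$ be the set of positive divisors of $\gcd(l,k)$ that are coprime with $\omega$. Then $$|\mathcal{P}_{l,k}(C_n(a,b))|=\frac{n}{l}\sum_{q\in Q}\ \sum_{m\mid \gcd(l,k)/q}\mu(m)\binom{l/(qm)}{k/(qm)},$$ where $\mu$ is the Möbius function.
   Context: Let $n\ge 2$ and $0<a<b<n$ be integers; $C_n(a,b)$ is connected iff $\gcd(n,a,b)=1$. $C_n(a,b)$ has vertex set $\mathbb{Z}_n$ and directed bonds $(v,v+a)$, $(v,v+b)$ (addition mod $n$), with step sizes $a$, $b$. A path of length $l$ is a sequence of bonds $(e_1,\dots,e_l)$ with the terminus of $e_j$ equal to the origin of $e_{j+1}$; its $b$-count is the number of bonds of step size $b$; a circuit is a path whose last terminus equals its first origin. A periodic orbit is an equivalence class of circuits under cyclic rotation $(e_1,\dots,e_l)\mapsto(e_2,\dots,e_l,e_1)$; it is primitive if it is not $[c_0^r]$ for a circuit $c_0$ and $r>1$ ($c_0^r$ = concatenation of $r$ copies). $\mathcal{P}_{l,k}(C_n(a,b))$ is the set of primitive periodic orbits of length $l$ and $b$-count $k$. *)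

(* Defs.v *)
From Stdlib Require Import ClassicalEpsilon.
From mathcomp Require Import all_boot all_order all_algebra.
Set Implicit Arguments. Unset Strict Implicit. Unset Printing Implicit Defensive.
Import Order.TTheory GRing.Theory Num.Theory.

Definition pbool (P : Prop) : bool :=
  if excluded_middle_informative P then true else false.

Section Circulant.
Variables (n a b : nat).

(* A bond of C_n(a,b): its origin v and whether its step size is b (true)
   or a (false).  Since 0 < a < b < n the two bonds out of v are distinct. *)
Definition bond := ('I_n * bool)%type.

Definition origin (e : bond) : nat := val e.1.
Definition terminus (e : bond) : nat := (val e.1 + (if e.2 then b else a)) %% n.
Definition step (e : bond) : nat := if e.2 then b else a.

Definition linked (e f : bond) : bool := terminus e == origin f.

Definition is_path (c : seq bond) : bool := sorted linked c.

Definition is_circuit (c : seq bond) : bool :=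
  match c with
  | [::] => false
  | e :: _ => is_path c && linked (last e c) e
  end.

Definition bcount (c : seq bond) : nat := count (fun e : bond => e.2) c.

Definition cpow (c0 : seq bond) (r : nat) : seq bond := flatten (nseq r c0).

Definition orbit (l : nat) (c : seq bond) : {set l.-tuple bond} :=
  [set t : l.-tuple bond | [exists i : 'I_l, val t == rot i c]].

Definition primitive_orbit (l : nat) (O : {set l.-tuple bond}) : Prop :=
  ~ (exists (c0 : seq bond) (r : nat), 1 < r /\ is_circuit c0 /\ O = orbit l (cpow c0 r)).

Definition Pset (l k : nat) : {set {set l.-tuple bond}} :=
  [set O : {set l.-tuple bond} |
     pbool ((exists c : l.-tuple bond,
               is_circuit c /\ bcount c = k /\ O = orbit l c)
            /\ primitive_orbit O)].

End Circulant.

Definition moebius (m : nat) : int :=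
  if (0 < m) && all (fun p => logn p m == 1%N) (primes m)
  then ((-1) ^+ size (primes m))%R else 0%R.

(* Main.v *)
(** A circuit of C_n(a, b) is a starting vertex together with a binary word w of
length l and weight k. If w = u ^ e with e maximal, the circuit is a proper power
exactly when some j < e copies of u already close up; since e copies travel
omega * n, none does iff e is coprime with omega. The cyclic rotations thus split
the n * #|{w | coprime (e w) omega}| aperiodic circuits into orbits of size l.
Conversely d %| e w holds for exactly 'C(l / d, k / d) words, so exchanging the
sums over words and over (q, m) turns the double sum into that number of words,
because the Moebius function sums to [q = e w] over the m with q * m %| e w. *)
Require Import Defs.
From mathcomp Require Import all_boot all_order all_algebra.
Set Implicit Arguments. Unset Strict Implicit. Unset Printing Implicit Defensive.
Import Order.TTheory GRing.Theory Num.Theory.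
Local Open Scope nat_scope.

(** * The Möbius function and its sum over divisors *)

Lemma moebius_mul_prime p m : prime p -> 0 < m -> ~~ (p %| m) ->
  moebius (p * m) = (- moebius m)%R.
Proof.
move=> pr_p m_gt0 pNm; have p_gt0 := prime_gt0 pr_p.
have pm_gt0 : 0 < p * m by rewrite muln_gt0 p_gt0.
have pNprimes : p \notin primes m by rewrite mem_primes pr_p m_gt0.
have eq_primes : perm_eq (primes (p * m)) (p :: primes m).
  apply: uniq_perm; first exact: primes_uniq.
    by rewrite /= pNprimes primes_uniq.
  by move=> q; rewrite primesM // (primes_prime pr_p) !inE.
rewrite /moebius pm_gt0 m_gt0 (perm_all _ eq_primes) (perm_size eq_primes) /=.
rewrite lognM // (logn_prime _ pr_p) eqxx.
have -> : logn p m = 0 by apply/eqP; rewrite -leqn0 leqNgt logn_gt0.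
rewrite /=; have -> : all (fun q => logn q (p * m) == 1) (primes m)
   = all (fun q => logn q m == 1) (primes m).
  apply: eq_in_all => q q_m; rewrite lognM // (logn_prime _ pr_p).
  by case: (eqVneq q p) q_m => // ->; rewrite (negPf pNprimes).
by case: ifP; rewrite ?oppr0 // exprS mulN1r.
Qed.

Lemma moebius_sq_dvd p m : prime p -> p ^ 2 %| m -> moebius m = 0%R.
Proof.
move=> pr_p p2m; rewrite /moebius; case: (posnP m) => //= m_gt0.
case: allP => // /(_ p); rewrite mem_primes pr_p m_gt0.
rewrite (dvdn_trans _ p2m) ?dvdn_exp // => /(_ isT) /eqP log1.
by move: p2m; rewrite pfactor_dvdn // log1.
Qed.

(* For a prime p dividing N, the divisors m prime to p cancel against the p * m,
   and the remaining divisors are divisible by p ^ 2. *)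
Lemma sum_moebius_divisors N : 0 < N ->
  (\sum_(m <- divisors N) moebius m = (N == 1)%:R)%R.
Proof.
move=> N_gt0; case: eqVneq => [->|N_neq1].
  by rewrite big_seq1.
have N_gt1 : 1 < N by rewrite ltn_neqAle eq_sym N_neq1.
have pr_p := pdiv_prime N_gt1; have pN := pdiv_dvd N.
move: (pdiv N) pr_p pN => p pr_p pN; have p_gt0 := prime_gt0 pr_p.
rewrite (bigID (fun m => p %| m)) /= (bigID (fun m => p ^ 2 %| m)) /=.
rewrite big1 ?add0r => [|m /andP[_]]; last exact: moebius_sq_dvd.
rewrite -big_filter.
rewrite (perm_big [seq p * m | m <- divisors N & ~~ (p %| m)]) /=; last first.
  apply: uniq_perm; first by rewrite filter_uniq ?divisors_uniq.
    rewrite map_inj_in_uniq ?filter_uniq ?divisors_uniq // => x y _ _ /eqP.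
    by rewrite eqn_pmul2l // => /eqP.
  move=> x; rewrite mem_filter -dvdn_divisors //.
  apply/andP/mapP => [[/andP[/dvdnP[m ->]]]|[m]].
    rewrite mulnC -mulnn dvdn_pmul2l // => pNm pmN.
    by exists m => //; rewrite mem_filter pNm -dvdn_divisors // (dvdn_trans _ pmN) ?dvdn_mull.
  rewrite mem_filter -dvdn_divisors // => /andP[pNm mN] ->.
  rewrite dvdn_mulr // -mulnn dvdn_pmul2l // pNm; split=> //.
  by rewrite Gauss_dvd ?pN // prime_coprime.
rewrite big_map big_filter -big_split /= big_seq_cond big1 // => m.
rewrite -dvdn_divisors // => /andP[mN pNm].
by rewrite moebius_mul_prime ?(dvdn_gt0 N_gt0) // addNr.
Qed.

(** * Rotation of tuples and its order *)

Lemma iter_fixed_order (T : finType) (f : T -> T) (x : T) i : injective f ->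
  (iter i f x == x) = (order f x %| i).
Proof.
move=> f_inj; have iterM j : iter (j * order f x) f x = x.
  by elim: j => // j IHj; rewrite mulSn iterD IHj iter_order.
apply/eqP/dvdnP => [fix_i|[j ->]]; last exact: iterM.
exists (i %/ order f x); rewrite {1}(divn_eq i (order f x)).
move: fix_i; rewrite {1}(divn_eq i (order f x)) addnC iterD iterM => fix_i.
(* The remainder of [i] is below the order, so it is the index of [iter i f x = x] in the cycle of
   [x], which is 0. *)
have := findex_iter (ltn_pmod i (order_gt0 f x)).
by rewrite fix_i findex0 => <-.
Qed.

(** Rotation as a self-map of tuples, so that [order], [findex] and [fconnect] apply when [T] is
    finite. *)
Definition rot1 (T : Type) l (t : l.-tuple T) : l.-tuple T := [tuple of rot 1 t].
Arguments rot1 {T l}.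

Section Rotation.
Variables (T : finType) (l : nat).
Implicit Type t : l.-tuple T.

Lemma rot1_inj : injective (@rot1 T l).
Proof. by move=> s t /(congr1 val)/= /rot_inj /val_inj. Qed.

Lemma val_iter_rot1 t i : i <= l -> val (iter i rot1 t) = rot i t.
Proof.
elim: i => [|i IHi] le_il; first by rewrite rot0.
by rewrite iterS /= IHi ?(ltnW le_il) // -rotS ?size_tuple.
Qed.

Lemma rot_fixed t i : i <= l -> (rot i t == t) = (order rot1 t %| i).
Proof.
by move=> le_il; rewrite -(iter_fixed_order _ _ (@rot1_inj)) -val_eqE /= val_iter_rot1.
Qed.

Lemma order_rot1_dvd t : order rot1 t %| l.
Proof. by rewrite -rot_fixed // -{1}(size_tuple t) rot_size. Qed.

Lemma rot_order t : rot (order rot1 t) t = t.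
Proof.
(* On the empty tuple the order is 1, which exceeds [l = 0], so [rot_fixed] does not cover it. *)
case: (posnP l) => [l0|l_gt0]; last first.
  by apply/eqP; rewrite rot_fixed ?dvdnn // dvdn_leq ?order_rot1_dvd.
by rewrite [val t]size0nil // size_tuple.
Qed.

End Rotation.

(** * Powers of words *)

Section Power.
Variable T : Type.
Implicit Types u s w : seq T.

Lemma size_flatten_nseq q u : size (flatten (nseq q u)) = q * size u.
Proof. by elim: q => //= q IHq; rewrite size_cat IHq. Qed.

Lemma flatten_nseq_catC q u : flatten (nseq q u) ++ u = u ++ flatten (nseq q u).
Proof. by elim: q => [|q IHq] /=; rewrite ?cats0 // -catA IHq. Qed.

Lemma rot_flatten_nseq q u :
  rot (size u) (flatten (nseq q u)) = flatten (nseq q u).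
Proof. by case: q => //= q; rewrite rot_size_cat flatten_nseq_catC. Qed.

(** Commutation makes [u] a prefix of a nonempty [s]; what follows this prefix still commutes with
    [u], so copies of [u] can be peeled off by induction. *)
Lemma commute_flatten_nseq q u s : size s = q * size u -> s ++ u = u ++ s ->
  s = flatten (nseq q u).
Proof.
elim: q s => [|q IHq] s /= sz_s comm_s; first exact: size0nil.
have le_us : size u <= size s by rewrite sz_s leq_addr.
have := congr1 (take (size u)) comm_s; rewrite takel_cat // take_size_cat // => tk.
rewrite -(cat_take_drop (size u) s) tk; congr (_ ++ _); apply: IHq.
  by rewrite size_drop sz_s mulSn addKn.
move: comm_s; rewrite -{1 2}(cat_take_drop (size u) s) tk -catA.
move/(congr1 (drop (size u))); by rewrite !drop_size_cat.
Qed.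

(** Invariance under [rot p] says that [take p w] and [drop p w] commute. *)
Lemma rot_fixed_flatten_nseq p q w : size w = q * p -> rot p w = w ->
  w = flatten (nseq q (take p w)).
Proof.
case: q => [|q] sz_w rot_w; first exact: size0nil.
have le_pw : p <= size w by rewrite sz_w leq_addr.
rewrite -{1}(cat_take_drop p w) /=; congr (_ ++ _).
apply: commute_flatten_nseq.
  by rewrite size_drop size_takel // sz_w mulSn addKn.
by rewrite cat_take_drop -{3}rot_w.
Qed.

Lemma take_flatten_nseq j q u : j <= q ->
  take (j * size u) (flatten (nseq q u)) = flatten (nseq j u).
Proof.
move=> le_jq; rewrite -(subnKC le_jq) nseqD flatten_cat.
by rewrite take_size_cat // size_flatten_nseq.
Qed.

Lemma count_flatten_nseq (a : pred T) q u :
  count a (flatten (nseq q u)) = q * count a u.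
Proof. by elim: q => //= q IHq; rewrite count_cat IHq. Qed.

End Power.

(** * Counting binary words of given weight and rotational symmetry *)

Lemma card_count_tuple n k : #|[set w : n.-tuple bool | count id w == k]| = 'C(n, k).
Proof.
(* Words are indicator functions of subsets of ['I_n], weight being cardinality. *)
pose f (A : {set 'I_n}) := [tuple i \in A | i < n].
have f_inj : injective f.
  move=> A B /(congr1 (fun t => tnth t)) eqAB; apply/setP => i.
  by have := congr1 (@^~ i) eqAB; rewrite !tnth_mktuple.
have f_count A : count id (f A) = #|A|.
  rewrite /= count_map -sum1_count big_enum_cond /= sum1_card.
  by apply: eq_card => i.
rewrite -[in RHS](card_ord n) -card_draws -(card_imset _ f_inj).
apply: eq_card => w; rewrite !inE; apply/eqP/imsetP => [count_w|[A]].
  exists [set i | tnth w i].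
    rewrite inE -f_count; apply/eqP; rewrite -[RHS]count_w; congr (count _ (val _)).
    by apply: eq_from_tnth => i; rewrite tnth_mktuple inE.
  by apply: eq_from_tnth => i; rewrite tnth_mktuple inE.
by rewrite inE => /eqP <- ->; rewrite f_count.
Qed.

(** The words fixed by [rot p] are the powers [u ^ d] with [u] of length [p]; the weight of [u] is
    then [j], and [u] is recovered as the first [p] letters. *)
Lemma card_count_rot_tuple d p j l : 0 < d -> l = d * p ->
  #|[set w : l.-tuple bool | (count id w == d * j) && (rot p w == w)]| = 'C(p, j).
Proof.
move=> d_gt0 def_l.
have szf (u : p.-tuple bool) : size (flatten (nseq d (val u))) == l.
  by rewrite size_flatten_nseq size_tuple def_l.
pose f u : l.-tuple bool := Tuple (szf u).
have f_inj : injective f.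
  move=> u v /(congr1 val)/= /(congr1 (take p)).
  have := take_flatten_nseq (val u) d_gt0.
  have := take_flatten_nseq (val v) d_gt0.
  by rewrite !mul1n !size_tuple /= !cats0 => -> -> /val_inj.
rewrite -card_count_tuple -(card_imset _ f_inj).
apply: eq_card => w; rewrite !inE; apply/andP/imsetP => [[/eqP cw /eqP rw]|[u]].
  have def_w : val w = flatten (nseq d (take p w)).
    by apply: rot_fixed_flatten_nseq; rewrite ?size_tuple.
  have szu : size (take p w) == p.
    by rewrite size_takel // size_tuple def_l leq_pmull.
  exists (Tuple szu); last exact: val_inj.
  rewrite inE /= -(eqn_pmul2l d_gt0) -cw -count_flatten_nseq -def_w //.
rewrite inE => /eqP <- ->; rewrite /= count_flatten_nseq; split=> //.
by rewrite -{1}(size_tuple u) rot_flatten_nseq.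
Qed.

(** * Circuits as walks given by a starting vertex and a word *)

Section Circulant.
Variables n' a b : nat.
Local Notation n := n'.+1.
Implicit Types (c : seq (bond n)) (w : seq bool).

Definition step_size (x : bool) := if x then b else a.

Definition dist w := sumn [seq step_size x | x <- w].

(** The position stays an unreduced natural number, so that distances simply add; only the recorded
    origins are reduced mod [n]. *)
Fixpoint walk (v : nat) w : seq (bond n) :=
  if w is x :: w' then (inZp v, x) :: walk (v + step_size x) w' else [::].

Lemma dist_cat w1 w2 : dist (w1 ++ w2) = dist w1 + dist w2.
Proof. by rewrite /dist map_cat sumn_cat. Qed.

Lemma dist_rot i w : dist (rot i w) = dist w.
Proof. by rewrite /rot dist_cat addnC -dist_cat cat_take_drop. Qed.

Lemma dist_flatten_nseq q w : dist (flatten (nseq q w)) = q * dist w.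
Proof. by elim: q => //= q IHq; rewrite dist_cat IHq. Qed.

(** Every bond advances by [a], a [b]-bond by a further [b - a]. This is the quantity that the
    theorem sets equal to [omega * n]. *)
Lemma distE w : a <= b -> dist w = size w * a + count id w * (b - a).
Proof.
move=> le_ab; elim: w => //= x w; rewrite /dist /= => ->.
have -> : step_size x = a + x * (b - a) by case: x; rewrite /= ?mul1n ?addn0 ?subnKC.
by rewrite mulSn mulnDl addnACA.
Qed.

Lemma walk_cat v w1 w2 : walk v (w1 ++ w2) = walk v w1 ++ walk (v + dist w1) w2.
Proof.
by elim: w1 v => [|x w1 IHw] v /=; rewrite ?addn0 // IHw -addnA.
Qed.

Lemma inZp_eq_mod u v : (inZp u == inZp v :> 'I_n) = (u == v %[mod n]).
Proof. by rewrite -val_eqE. Qed.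

Lemma walk_mod u v w : u = v %[mod n] -> walk u w = walk v w.
Proof.
elim: w u v => //= x w IHw u v eq_uv; congr ((_, _) :: _).
  by apply/eqP; rewrite inZp_eq_mod eq_uv.
by apply: IHw; rewrite -modnDml eq_uv modnDml.
Qed.

Lemma map_snd_walk v w : map snd (walk v w) = w.
Proof. by elim: w v => //= x w IHw v; rewrite IHw. Qed.

Lemma size_walk v w : size (walk v w) = size w.
Proof. by rewrite -[in RHS](map_snd_walk v w) size_map. Qed.

Lemma bcount_walk v w : bcount (walk v w) = count id w.
Proof. by rewrite -[in RHS](map_snd_walk v w) count_map. Qed.

(** The first bond records the start mod [n]; an empty walk has no such record, hence the size
    condition. *)
Lemma eq_walk u v w w' : 0 < size w ->
  (walk u w == walk v w') = (u == v %[mod n]) && (w == w').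
Proof.
case: w => // x w _; apply/eqP/andP => [eq_uv|[/eqP/walk_mod <- /eqP <-] //].
have := congr1 (map snd) eq_uv; rewrite !map_snd_walk => def_w'.
move: eq_uv; rewrite -def_w' /= => -[/eqP]; rewrite -inZp_eq_mod.
by rewrite eqxx.
Qed.

Lemma path_linkedE (e : bond n) c :
  path (linked a b) e c = (c == walk (e.1 + step_size e.2) (map snd c)).
Proof.
elim: c e => //= f c IHc e; rewrite eqseq_cons -pair_eqE /= eqxx andbT IHc.
have -> : (f.1 == inZp (e.1 + step_size e.2)) = linked a b e f.
  by rewrite -val_eqE eq_sym.
rewrite /linked; case: eqP => //= def_f; rewrite (@walk_mod _ (f.1 + step_size f.2)) //.
rewrite -modnDml; congr ((_ + _) %% _); exact: def_f.
Qed.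

Lemma terminus_last_walk (e : bond n) w :
  terminus a b (last e (walk (e.1 + step_size e.2) w))
  = (e.1 + step_size e.2 + dist w) %% n.
Proof.
elim: w e => [|x w IHw] e /=; first by rewrite addn0.
rewrite (@walk_mod _ ((inZp (e.1 + step_size e.2) : 'I_n) + step_size x)).
  by rewrite (IHw (_, _)) /= -addnA modnDml.
by rewrite /= modnDml.
Qed.

(** Consecutive bonds of a walk are linked by construction, so only the return to the start is a
    condition. *)
Lemma is_circuit_walk v w :
  is_circuit a b (walk v w) = (0 < size w) && (n %| dist w).
Proof.
case: w => //= x w; set e : bond n := (inZp v, x).
have -> : walk (v + step_size x) w = walk (e.1 + step_size e.2) w.
  by apply: walk_mod; rewrite /= modnDml.
rewrite path_linkedE map_snd_walk eqxx /linked terminus_last_walk /origin.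
rewrite -addnA -[X in _ == X](modn_small (ltn_ord e.1)).
by rewrite -{2}[val e.1]addn0 eqn_modDl mod0n.
Qed.

Lemma circuit_is_walk c :
  is_circuit a b c -> exists v : 'I_n, c = walk v (map snd c).
Proof.
case: c => // e c /andP[]; rewrite /is_path /= path_linkedE => /eqP def_c _.
by exists e.1; rewrite /= valZpK -def_c; case: e {def_c}.
Qed.

Lemma rot_walk v w i : n %| dist w ->
  rot i (walk v w) = walk (v + dist (take i w)) (rot i w).
Proof.
move=> closed_w; rewrite -{1}(cat_take_drop i w) walk_cat.
rewrite /rot walk_cat -addnA -dist_cat cat_take_drop.
(* The initial segment, moved to the end, would start at [v + dist w], which is [v] mod [n] because
   the walk closes up. *)
rewrite (@walk_mod (v + dist w) v); last first.
  by rewrite -{2}[v]addn0; apply/eqP; rewrite eqn_modDl mod0n.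
case: (leqP i (size w)) => [le_iw|/ltnW le_wi].
  have sz : size (walk v (take i w)) = i by rewrite size_walk size_takel.
  by rewrite drop_size_cat // take_size_cat.
by rewrite (drop_oversize le_wi) take_oversize //= cats0 drop_oversize ?take_oversize
  ?cats0 // size_walk.
Qed.

Lemma is_circuit_rot c i : is_circuit a b c -> is_circuit a b (rot i c).
Proof.
move=> circ_c; have [v def_c] := circuit_is_walk circ_c.
move: circ_c; rewrite def_c is_circuit_walk => /andP[w_gt0 closed_w].
by rewrite rot_walk // is_circuit_walk size_rot dist_rot w_gt0.
Qed.

Lemma bcount_rot c i : bcount (rot i c) = bcount c.
Proof. by apply/permP; rewrite perm_rot. Qed.

(** * Primitive orbits as rotation classes of full size *)

Lemma mem_orbit l (c t : l.-tuple (bond n)) : 0 < l ->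
  (t \in Defs.orbit l c) = fconnect rot1 c t.
Proof.
move=> l_gt0; rewrite inE; apply/existsP/idP => [[i /eqP def_t]|c_t].
  by rewrite (_ : t = iter i rot1 c) ?fconnect_iter //; apply: val_inj;
     rewrite val_iter_rot1 ?(ltnW (ltn_ord i)).
have lt_il : findex rot1 c t < l.
  exact: leq_trans (findex_max c_t) (dvdn_leq l_gt0 (order_rot1_dvd c)).
by exists (Ordinal lt_il); rewrite -{1}(iter_findex c_t) val_iter_rot1 ?(ltnW lt_il).
Qed.

(** If the order [p] is below [l], then [c] is a proper power of its first [p] bonds. Conversely a
    rotation of [c0 ^ r] with [r > 1] is fixed by rotating through [size c0 < l] places. *)
Lemma primitive_orbitP l (c : l.-tuple (bond n)) : 0 < l -> is_circuit a b c ->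
  primitive_orbit a b (Defs.orbit l c) <-> order rot1 c = l.
Proof.
move=> l_gt0 circ_c; set p := order rot1 c.
have pl : p %| l := order_rot1_dvd c.
have le_pl : p <= l by apply: dvdn_leq.
have p_gt0 : 0 < p by apply: order_gt0.
split=> [prim|order_c [c0 [r [r_gt1 [circ_c0 eqO]]]]].
  apply/eqP; rewrite eqn_leq le_pl leqNgt; apply/negP => lt_pl; apply: prim.
  have rot_c : rot p c = c := rot_order c.
  have def_c : val c = flatten (nseq (l %/ p) (take p c)).
    by apply: rot_fixed_flatten_nseq; rewrite ?size_tuple ?divnK.
  exists (take p c), (l %/ p); split; first by rewrite ltn_divRL // mul1n.
  rewrite /cpow -def_c; split=> //.
  have [v def_cv] := circuit_is_walk circ_c; move: circ_c rot_c.
  rewrite def_cv is_circuit_walk => /andP[_ closed_w].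
  (* Comparing starting vertices in [rot p c = c] gives that [n] divides the distance of the first
     [p] steps: the root is itself a circuit. *)
  rewrite rot_walk // => /eqP; rewrite eq_walk; last first.
    by rewrite size_rot size_map size_tuple.
  rewrite -{2}[v : nat]addn0 eqn_modDl mod0n -/(dvdn _ _) => /andP[closed_u _].
  set w := map snd c in closed_w closed_u *.
  rewrite -[w in walk v w](cat_take_drop p) walk_cat take_size_cat; last first.
    by rewrite size_walk size_takel // size_map size_tuple.
  by rewrite is_circuit_walk closed_u size_takel ?p_gt0 // size_map size_tuple.
have : c \in Defs.orbit l c by rewrite mem_orbit ?connect0.
rewrite eqO inE => /existsP[i /eqP def_c].
have := congr1 size def_c; rewrite size_tuple size_rot size_flatten_nseq => def_l.
have c0_gt0 : 0 < size c0 by case: (c0) circ_c0.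
have lt_c0l : size c0 < l by rewrite def_l ltn_Pmull.
have : rot (size c0) c == c.
  by rewrite def_c rot_rot rot_flatten_nseq.
by rewrite rot_fixed ?(ltnW lt_c0l) // -/p order_c => /(dvdn_leq c0_gt0); rewrite leqNgt lt_c0l.
Qed.

Definition aperiodic_circuits l k : {set l.-tuple (bond n)} :=
  [set c : l.-tuple (bond n) |
    [&& is_circuit a b c, bcount c == k & order rot1 c == l]].

Lemma pboolP P : reflect P (pbool P).
Proof.
by rewrite /pbool; case: ClassicalEpsilon.excluded_middle_informative; constructor.
Qed.

Lemma Pset_imset l k : 0 < l ->
  Pset n a b l k = (fun c : l.-tuple (bond n) => Defs.orbit l c) @: aperiodic_circuits l k.
Proof.
move=> l_gt0; apply/setP => O; rewrite inE.
apply/pboolP/imsetP => [[[c [circ_c [k_c ->]]] prim]|[c]].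
  by exists c; rewrite // inE circ_c k_c eqxx; apply/eqP/primitive_orbitP.
rewrite inE => /and3P[circ_c /eqP k_c /eqP ord_c] ->; split; first by exists c.
exact/primitive_orbitP.
Qed.

(** The fibre of the orbit map through [c] is the [rot1]-cycle of [c], of size [order rot1 c = l];
    the order and the other conditions are constant along it. *)
Lemma card_aperiodic_circuits l k : 0 < l ->
  #|aperiodic_circuits l k| = #|Pset n a b l k| * l.
Proof.
move=> l_gt0; rewrite Pset_imset // -sum1_card.
rewrite (partition_big_imset (fun c : l.-tuple (bond n) => Defs.orbit l c)) /=.
rewrite -sum_nat_const; apply: eq_bigr => O /imsetP[c].
rewrite inE => /and3P[circ_c k_c /eqP order_c] ->.
rewrite (eq_bigl (fconnect rot1 c)) => [|t].
  rewrite sum1dep_card -[RHS]order_c; apply: eq_card => t.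
  by rewrite inE [RHS]unfold_in.
apply/andP/idP => [[_ /eqP eqO]|c_t].
  by rewrite -mem_orbit // -eqO mem_orbit ?connect0.
have sym_f : connect_sym (frel (@rot1 (bond n) l)) := fconnect_sym (@rot1_inj _ l).
have eq_f := same_connect sym_f c_t.
split; last by apply/eqP/setP => s; rewrite !mem_orbit // eq_f.
have order_t : order rot1 t = l.
  by apply: etrans order_c; apply: eq_card => s; apply/esym/eq_f.
have lt_il : findex rot1 c t < l.
  exact: leq_trans (findex_max c_t) (dvdn_leq l_gt0 (order_rot1_dvd c)).
rewrite inE order_t eqxx andbT -(iter_findex c_t).
by rewrite val_iter_rot1 ?(ltnW lt_il) // is_circuit_rot // bcount_rot.
Qed.

(** * Exponents of words and the count of aperiodic circuits *)

Definition exponent l (w : l.-tuple bool) := l %/ order rot1 w.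

(* The word w is u ^ e for its exponent e, and j copies of u close up iff
   e %| j * omega. *)
Lemma aperiodic_walk l (c : l.-tuple (bond n)) (w : l.-tuple bool) v om :
    0 < l -> val c = walk v w -> dist w = om * n ->
  (order rot1 c == l) = coprime (exponent w) om.
Proof.
move=> l_gt0 def_c dist_w; rewrite /exponent; set p := order rot1 w; set e := l %/ p.
have pl : p %| l := order_rot1_dvd w.
have def_l : l = e * p by rewrite divnK.
have e_gt0 : 0 < e by move: l_gt0; rewrite def_l muln_gt0 => /andP[].
have p_gt0 : 0 < p by apply: order_gt0.
have def_w : val w = flatten (nseq e (take p w)).
  by apply: rot_fixed_flatten_nseq; [rewrite size_tuple | exact: rot_order].
set u := take p w in def_w *.
have sz_u : size u = p by rewrite size_takel // size_tuple dvdn_leq.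
have dist_u : e * dist u = om * n by rewrite -dist_w def_w dist_flatten_nseq.
have closed_w : n %| dist w by rewrite dist_w dvdn_mull.
(* A rotation fixes the circuit exactly when it fixes both the starting vertex and the word. *)
have order_c i : i <= l ->
    (order rot1 c %| i) = (n %| dist (take i w)) && (p %| i).
  move=> le_il; rewrite -!rot_fixed // def_c rot_walk // eq_walk.
    by rewrite -{2}[v]addn0 eqn_modDl mod0n.
  by rewrite size_rot size_tuple.
have order_cM j : j <= e -> (order rot1 c %| j * p) = (e %| j * om).
  move=> le_je; rewrite order_c; last by rewrite [leqRHS]def_l leq_mul2r le_je orbT.
  rewrite dvdn_mull // andbT def_w -{1}sz_u take_flatten_nseq // dist_flatten_nseq.
  by rewrite -(dvdn_pmul2l e_gt0) mulnCA dist_u mulnA dvdn_pmul2r.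
have ordl : order rot1 c <= l by rewrite dvdn_leq ?order_rot1_dvd.
apply/eqP/idP => [eq_l|cop].
  (* Already [e %/ g] copies of [u] close up, so full order forces [g = 1]. *)
  set g := gcdn e om; have ge : g %| e by apply: dvdn_gcdl.
  have e_dvd : e %| e %/ g * om.
    by rewrite -(divnK (dvdn_gcdr e om)) mulnCA divnK // dvdn_mull.
  have := order_cM _ (leq_div e g); rewrite e_dvd eq_l [X in X %| _]def_l dvdn_pmul2r //.
  have eg_gt0 : 0 < e %/ g by rewrite divn_gt0 ?gcdn_gt0 ?e_gt0 // dvdn_leq.
  move/(dvdn_leq eg_gt0); rewrite /coprime eqn_leq gcdn_gt0 e_gt0 andbT.
  by apply: contraTT; rewrite -!ltnNge => /ltn_Pdiv->.
(* The order of [c] is [j * p] for some [j], as it fixes the word; then [e] divides [j * om], hence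
   [j] by coprimality. *)
have := order_c _ ordl; rewrite dvdnn => /esym/andP[_ /dvdnP[j def_j]].
have le_je : j <= e by rewrite -(leq_pmul2r p_gt0) -def_j -def_l.
have := order_cM _ le_je; rewrite -def_j dvdnn Gauss_dvdl // => /esym e_j.
apply/eqP; rewrite eqn_dvd order_rot1_dvd def_j.
by rewrite [X in X %| _]def_l dvdn_pmul2r.
Qed.

Lemma exponent_dvd l k (w : l.-tuple bool) :
  count id w = k -> exponent w %| gcdn l k.
Proof.
have pl := order_rot1_dvd w; rewrite /exponent; set p := order _ _ in pl * => <-.
rewrite dvdn_gcd -{2}(divnK pl) dvdn_mulr //=.
have def_w : val w = flatten (nseq (l %/ p) (take p w)).
  by apply: rot_fixed_flatten_nseq; [rewrite size_tuple divnK | exact: rot_order].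
by rewrite [X in _ %| count id X]def_w count_flatten_nseq dvdn_mulr.
Qed.

(** With [p] the order of [w], both sides say that [d * p] divides [l]. *)
Lemma dvdn_exponent l d (w : l.-tuple bool) : 0 < l -> d %| l ->
  (d %| exponent w) = (rot (l %/ d) w == w).
Proof.
move=> l_gt0 dl; have d_gt0 := dvdn_gt0 l_gt0 dl.
rewrite rot_fixed ?leq_div // /exponent dvdn_divRL ?order_rot1_dvd //.
by rewrite mulnC -dvdn_divRL.
Qed.

(** All words of length [l] and weight [k] travel the distance [om * n], so each closes up from each
    of the [n] vertices; [walk] is the bijection, and aperiodicity depends on the word alone. *)
Lemma card_aperiodic_circuits_words l k om : 0 < l -> a <= b ->
    l * a + k * (b - a) = om * n ->
  #|aperiodic_circuits l k| =
    n * #|[set w : l.-tuple bool | (count id w == k) && coprime (exponent w) om]|.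
Proof.
move=> l_gt0 le_ab def_om; set W := [set w | _].
have sz_walk (vw : 'I_n * l.-tuple bool) : size (walk vw.1 vw.2) == l.
  by rewrite size_walk size_tuple.
pose f vw : l.-tuple (bond n) := Tuple (sz_walk vw).
have f_inj : injective f.
  move=> [u w] [v w'] /(congr1 val)/= /eqP; rewrite eq_walk ?size_tuple //.
  by rewrite !modn_small // => /andP[/eqP/val_inj-> /eqP/val_inj->].
rewrite -[X in X * _](card_ord n) -cardsT -cardsX -(card_imset _ f_inj).
have f_mem v (w : l.-tuple bool) : (f (v, w) \in aperiodic_circuits l k) = (w \in W).
  rewrite !inE is_circuit_walk bcount_walk size_tuple l_gt0 /=.
  case: eqP => [k_w|_]; last by rewrite andbF.
  have dist_w : dist w = om * n by rewrite distE // size_tuple k_w.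
  by rewrite dist_w dvdn_mull //=; apply: (aperiodic_walk _ _ dist_w).
apply: eq_card => c; apply/idP/imsetP => [c_per|[[v w] w_W ->]]; last first.
  by move: w_W; rewrite in_setX f_mem => /andP[].
have [v def_c] : exists v : 'I_n, val c = walk v (map snd c).
  by apply: circuit_is_walk; move: c_per; rewrite inE => /andP[].
have def_fc : c = f (v, [tuple of map snd c]) by apply: val_inj.
by exists (v, [tuple of map snd c]); rewrite // in_setX in_setT -(f_mem v) -?def_fc.
Qed.

End Circulant.

(** * The double sum as a number of words *)

Local Open Scope ring_scope.

(** If [q] divides [e], the indices [m] that remain are the divisors of [e %/ q], all of which
    divide [g %/ q]; otherwise none remains. *)
Lemma sum_moebius_dvd (g e q : nat) : (0 < g)%N -> (e %| g)%N -> (q %| g)%N ->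
  \sum_(m <- divisors (g %/ q) | (q * m %| e)%N) moebius m = (q == e)%:R.
Proof.
move=> g_gt0 eg qg; have q_gt0 := dvdn_gt0 g_gt0 qg; have e_gt0 := dvdn_gt0 g_gt0 eg.
have [qe|qNe] := boolP (q %| e)%N; last first.
  rewrite big1 => [|m qme]; first by case: eqP qNe => // ->; rewrite dvdnn.
  by move: qNe; rewrite (dvdn_trans _ qme) ?dvdn_mulr.
have eq_gt0 : (0 < e %/ q)%N by rewrite divn_gt0 // dvdn_leq.
have gq_gt0 : (0 < g %/ q)%N by rewrite divn_gt0 // dvdn_leq.
rewrite -big_filter (perm_big (divisors (e %/ q))) /=; last first.
  apply: uniq_perm; rewrite ?filter_uniq ?divisors_uniq // => m.
  rewrite mem_filter -!dvdn_divisors // !dvdn_divRL // mulnC.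
  by rewrite andb_idr // => /dvdn_trans->.
by rewrite sum_moebius_divisors // -(eqn_pmul2r q_gt0) divnK // mul1n eq_sym.
Qed.

Lemma sum_words_coprime (l k om : nat) : (0 < l)%N ->
  \sum_(q <- divisors (gcdn l k) | coprime q om)
     \sum_(m <- divisors (gcdn l k %/ q))
        moebius m * ('C(l %/ (q * m), k %/ (q * m)))%:R
  = #|[set w : l.-tuple bool | (count id w == k) && coprime (exponent w) om]|%:R.
Proof.
move=> l_gt0; set g := gcdn l k; have g_gt0 : (0 < g)%N by rewrite gcdn_gt0 l_gt0.
(* For each [q], the inner sum is the number of words of weight [k] with exponent exactly [q]. *)
transitivity (\sum_(q <- divisors g | coprime q om)
  \sum_(w : l.-tuple bool | count id w == k) (q == exponent w)%:R : int).
  rewrite [LHS]big_seq_cond [RHS]big_seq_cond; apply: eq_bigr => q /andP[].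
  rewrite -dvdn_divisors // => qg _; have q_gt0 := dvdn_gt0 g_gt0 qg.
  transitivity (\sum_(w : l.-tuple bool | count id w == k)
     \sum_(m <- divisors (g %/ q) | (q * m %| exponent w)%N) moebius m); last first.
    by apply: eq_bigr => w /eqP k_w; rewrite sum_moebius_dvd // exponent_dvd.
  (* After the exchange, [moebius m] is weighted by the number of words with [q * m] dividing the
     exponent, that is, fixed by rotation through [l %/ (q * m)] places. *)
  rewrite (exchange_big_dep predT) //= big_seq [RHS]big_seq; apply: eq_bigr => m.
  have gq_gt0 : (0 < g %/ q)%N by rewrite divn_gt0 // dvdn_leq.
  rewrite -(dvdn_divisors _ gq_gt0) => mgq.
  have qmg : (q * m %| g)%N by rewrite mulnC -dvdn_divRL.
  have qml : (q * m %| l)%N := dvdn_trans qmg (dvdn_gcdl l k).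
  have qmk : (q * m %| k)%N := dvdn_trans qmg (dvdn_gcdr l k).
  have qm_gt0 := dvdn_gt0 l_gt0 qml.
  have def_l : l = (q * m * (l %/ (q * m)))%N by rewrite mulnC divnK.
  rewrite -(card_count_rot_tuple (k %/ (q * m)) qm_gt0 def_l) sumr_const -[RHS]mulr_natr.
  congr (_ * _%:R); apply: eq_card => w.
  by rewrite !inE unfold_in (mulnC (q * m)%N) divnK // dvdn_exponent.
(* Each word contributes only at [q = exponent w], which does occur among the divisors of [g]. *)
rewrite -sum1_card natr_sum (exchange_big_dep (fun w : l.-tuple bool => count id w == k)) //=.
rewrite [RHS](eq_bigl (fun w : l.-tuple bool => (count id w == k) && coprime (exponent w) om)); last first.
  by move=> w; rewrite inE.
rewrite [RHS]big_mkcondr /=; apply: eq_bigr => w /eqP k_w.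
have e_g : exponent w \in divisors g by rewrite -dvdn_divisors // exponent_dvd.
rewrite big_mkcond (bigD1_seq (exponent w)) ?divisors_uniq //= eqxx.
rewrite big1 => [|q /negPf->]; last by case: ifP.
by rewrite addr0 k_w eqxx andbT.
Qed.

Theorem mainTheorem16 (n a b l k : nat) (omega : int) :
  (2 <= n)%N -> (0 < a)%N -> (a < b)%N -> (b < n)%N ->
  gcdn (gcdn n a) b = 1%N ->
  (1 <= l)%N -> (k <= l)%N ->
  ((l * a + k * (b - a))%N)%:Z = omega * n%:Z ->
  (#|Pset n a b l k|)%:R =
    (n%:R / l%:R : rat) *
    (\sum_(q <- divisors (gcdn l k) | coprime q `|omega|%N)
       \sum_(m <- divisors (gcdn l k %/ q))
          (moebius m)%:~R * ('C(l %/ (q * m), k %/ (q * m)))%:R).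
Proof.
case: n => // n _ _ lt_ab _ _ l_gt0 _ def_omega.
(* Absolute values turn the hypothesis into an identity in [nat]. *)
have def_om : (l * a + k * (b - a) = `|omega| * n.+1)%N.
  by rewrite -[LHS]absz_nat def_omega abszM.
have l_neq0 : l%:R != 0 :> rat by rewrite pnatr_eq0 -lt0n.
have := congr1 (intr : int -> rat) (sum_words_coprime k `|omega|%N l_gt0).
rewrite rmorph_sum /= => sum_eq.
under eq_bigr => q _ do under eq_bigr => m _ do
  rewrite -[X in _ * X](rmorph_nat (intr : int -> rat)) -rmorphM.
under eq_bigr => q _ do rewrite -rmorph_sum.
(* Cleared of the denominator [l], the claim equates two counts of the aperiodic circuits: [l] per
   orbit and [n] per word. *)
rewrite sum_eq /= mulrAC; apply: (mulIf l_neq0); rewrite mulfVK // -natrM.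
rewrite -card_aperiodic_circuits // (card_aperiodic_circuits_words l_gt0 (ltnW lt_ab) def_om).
by rewrite natrM rmorph_nat.
Qed.
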